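(* Let $T=3$, $L=\ell=1$, and suppose $\overline{V}\ge\underline{C}+V$ and $\overline{C}-\overline{V}-V\ge 0$. Then $\mathrm{conv}(P)$ is the set of all $(x_1,x_2,x_3,y_1,y_2,y_3,u_2,u_3)\in\mathbb{R}^8$ satisfying \begin{align*} & u_2\ge y_2-y_1,\quad u_3\ge y_3-y_2,\quad u_2\ge 0,\quad u_3\ge 0,\\ & x_1\ge\underline{C}y_1,\quad x_2\ge\underline{C}y_2,\quad x_3\ge\underline{C}y_3,\\ & u_2\le y_2,\quad u_3\le y_3,\quad y_1+u_2\le 1,\quad y_2+u_3\le 1,\\ & x_1\le\overline{V}y_1+(\overline{C}-\overline{V})(y_2-u_2),\\ & x_1\le\overline{V}y_1+V(y_2-u_2)+(\overline{C}-\overline{V}-V)(y_3-u_3),\\ & x_2\le\overline{C}y_2-(\overline{C}-\overline{V})u_2,\\ & x_2\le\overline{V}y_2+(\overline{C}-\overline{V})(y_3-u_3),\\ & x_3\le\overline{C}y_3-(\overline{C}-\overline{V})u_3,\\ & x_3\le(\overline{V}+V)y_3-Vu_3+(\overline{C}-\overline{V}-V)(y_2-u_2),\\ & x_2-x_1\le(\underline{C}+V)y_2-\underline{C}y_1-(\underline{C}+V-\overline{V})u_2,\\ & x_3-x_2\le(\underline{C}+V)y_3-\underline{C}y_2-(\underline{C}+V-\overline{V})u_3,\\ & x_1-x_2\le\overline{V}y_1-(\overline{V}-V)y_2-(\underline{C}+V-\overline{V})u_2,\\ & x_2-x_3\le\overline{V}y_2-(\overline{V}-V)y_3-(\underline{C}+V-\overline{V})u_3,\\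 & x_1-x_3\le\overline{V}y_1-\underline{C}y_3+V(y_2-u_2)+(\underline{C}+V-\overline{V})(y_3-u_3-u_2),\\ & x_3-x_1\le(\underline{C}+2V)y_3-\underline{C}y_1-(\underline{C}+2V-\overline{V})u_3-(\underline{C}+V-\overline{V})u_2,\\ & (\overline{C}-\underline{C}-2V)\bigl(x_1-\overline{V}y_1-V(y_2-u_2)\bigr)\le(\overline{C}-\overline{V}-V)(x_3-\underline{C}y_3),\\ & (\overline{C}-\underline{C}-2V)\bigl(x_3-(\overline{V}+V)y_3+Vu_3\bigr)\le(\overline{C}-\overline{V}-V)(x_1-\underline{C}y_1). \end{align*}
   Context: $T$ is the number of time periods, $L,\ell$ are positive integers (minimum-up and minimum-down time), and $\underline{C},\overline{C},\overline{V},V$ are real parameters (generation lower bound, generation upper bound, start-up/shut-down ramp rate, ramp rate in the stable region) with $0\le\underline{C}\le\overline{V}\le\overline{C}$ and $V>0$. For integers $a,b$, $[a,b]_{\mathbb{Z}}$ is the set of integers $i$ with $a\le i\le b$. $P$ is the set of $(x,y,u)\in\mathbb{R}_+^T\times\{0,1\}^T\times\{0,1\}^{T-1}$, with $x=(x_1,\dots,x_T)$, $y=(y_1,\dots,y_T)$, $u=(u_2,\dots,u_T)$, such that \begin{align*} &\textstyle\sum_{i=t-L+1}^{t}u_i\le y_t,\ t\in[L+1,T]_{\mathbb{Z}};\qquad \sum_{i=t-\ell+1}^{t}u_i\le 1-y_{t-\ell},\ t\in[\ell+1,T]_{\mathbb{Z}};\\ &y_t-y_{t-1}-u_t\le 0,\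 t\in[2,T]_{\mathbb{Z}};\qquad \underline{C}y_t\le x_t\le\overline{C}y_t,\ t\in[1,T]_{\mathbb{Z}};\\ &x_t-x_{t-1}\le Vy_{t-1}+\overline{V}(1-y_{t-1}),\ t\in[2,T]_{\mathbb{Z}};\qquad x_{t-1}-x_t\le Vy_t+\overline{V}(1-y_t),\ t\in[2,T]_{\mathbb{Z}}. \end{align*} $\mathrm{conv}(P)$ denotes the convex hull of $P$. *)

(* Defs.v *)
From mathcomp Require Import all_boot all_order all_algebra.
From mathcomp Require Import classical_sets reals convex.

Set Implicit Arguments.
Unset Strict Implicit.
Unset Printing Implicit Defensive.

Import Order.TTheory GRing.Theory Num.Theory.

Local Open Scope classical_set_scope.
Local Open Scope ring_scope.

Definition convex_hull (R : numDomainType) (M : lmodType R) (A : set M) :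
  set M := smallest (@convex_set R M) A.

Definition schedule (R : realType) (T : nat) : lmodType R :=
  ('rV[R]_T * 'rV[R]_T * 'rV[R]_T.-1)%type.

(* The entry of index t of a vector whose indices are s, s+1, ..., s+n-1.
   Only meaningful for s <= t < s + n: it is 0 for t >= s + n, and for t < s
   truncated subtraction makes it the first entry. *)
Definition entry_from (s : nat) (R : realType) (n : nat) (v : 'rV[R]_n)
    (t : nat) : R :=
  if insub (t - s)%N is Some i then v ord0 i else 0.

(* x and y are indexed by 1..T, u is indexed by 2..T. *)
Definition gen (R : realType) (T : nat) (z : schedule R T) (t : nat) : R :=
  entry_from 1 z.1.1 t.
Definition online (R : realType) (T : nat) (z : schedule R T) (t : nat) : R :=
  entry_from 1 z.1.2 t.
Definition startup (R : realType) (T : nat) (z : schedule R T) (t : nat) : R :=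
  entry_from 2 z.2 t.

(* L and l are the minimum-up and minimum-down times, Cl and Cu the
   lower and upper generation bounds, Vbar the start-up/shut-down ramp rate and
   V the ramp rate in the stable region.  The truncated subtractions t - L,
   t - l and t - 1 are exact on the ranges where they are used. *)
Definition commitment_set (R : realType) (T L l : nat) (Cl Cu Vbar V : R) :
    set (schedule R T) :=
  [set z | let x := gen z in let y := online z in let u := startup z in
    (forall t : nat, (1 <= t <= T)%N -> 0 <= x t) /\
    (forall t : nat, (1 <= t <= T)%N -> y t = 0 \/ y t = 1) /\
    (forall t : nat, (2 <= t <= T)%N -> u t = 0 \/ u t = 1) /\
    (forall t : nat, (L + 1 <= t <= T)%N ->
       \sum_(t - L + 1 <= i < t.+1) u i <= y t) /\
    (forall t : nat, (l + 1 <= t <= T)%N ->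
       \sum_(t - l + 1 <= i < t.+1) u i <= 1 - y (t - l)%N) /\
    (forall t : nat, (2 <= t <= T)%N -> y t - y (t - 1)%N - u t <= 0) /\
    (forall t : nat, (1 <= t <= T)%N -> Cl * y t <= x t <= Cu * y t) /\
    (forall t : nat, (2 <= t <= T)%N ->
       x t - x (t - 1)%N <= V * y (t - 1)%N + Vbar * (1 - y (t - 1)%N)) /\
    (forall t : nat, (2 <= t <= T)%N ->
       x (t - 1)%N - x t <= V * y t + Vbar * (1 - y t))].

Arguments commitment_set {R} T L l Cl Cu Vbar V.

(* Main.v *)
Require Import Defs.
From mathcomp Require Import all_boot all_order all_algebra.
From mathcomp Require Import interval_inference boolp classical_sets reals convex.
From mathcomp Require Import lra.

Import Order.TTheory GRing.Theory Num.Theory.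

Local Open Scope classical_set_scope.
Local Open Scope ring_scope.

Set Implicit Arguments.
Unset Strict Implicit.
Unset Printing Implicit Defensive.

(* After subtracting Cl * y from x and writing a = Vbar - Cl, b = Cu - Cl, a
   point of the hull is a sum over the on/off patterns y in {0,1}^3 of points
   of the scaled generation polytopes of these patterns, because u is
   determined by y at the integral points.  The marginals y and u fix the
   weights of the patterns up to two parameters: the weight r of 101, which is
   irrelevant because the two end periods of 101 are as independent as those of
   100 and 001, and the weight s of 111.  For a fixed s, Fourier-Motzkin
   elimination of the generations in the middle period describes the attainable
   x by finitely many inequalities, which are affine in s (in_pattern_sum).
   Eliminating s then yields exactly the listed inequalities; the two with
   coefficients Cu - Cl - 2 V and Cu - Vbar - V come from pairing the lower
   bound of s that the capacity of one end period imposes with the upper bound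
   that the ramp between the two end periods imposes. *)

Ltac splits := do ?[split | apply/andP; split].

(** * Elimination of one variable from a finite system of linear inequalities *)

Lemma exists_max_mem (R : realDomainType) (x : R) (r : seq R) :
  exists2 m, m \in x :: r & {in x :: r, forall y, y <= m}.
Proof.
elim: r => [|y r [m m_in m_ge]].
  by exists x => [|y]; rewrite ?mem_head // inE => /eqP->.
have [le_ym|lt_my] := leP y m.
  exists m => [|z]; first by move: m_in; rewrite !inE => /orP[]->; rewrite ?orbT.
  by rewrite !inE orbCA => /orP[/eqP->//|zxr]; apply: m_ge; rewrite inE.
exists y => [|z]; first by rewrite !inE eqxx orbT.
rewrite !inE orbCA => /orP[/eqP->//|zxr].
by apply: le_trans (ltW lt_my); apply: m_ge; rewrite inE.
Qed.

(* Fourier-Motzkin elimination of one variable.  The distinguished rows with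
   positive coefficients make the rows with coefficient 0 consequences of the
   pairwise conditions. *)
Lemma exists_scaled_between (R : realFieldType) (l u : R * R) (L U : seq (R * R)) :
    0 < l.1 -> 0 < u.1 -> all (fun k => 0 <= k.1) (L ++ U) ->
    allrel (fun j k => k.1 * j.2 <= j.1 * k.2) (l :: L) (u :: U) ->
  exists s, all (fun k => k.2 <= k.1 * s) (l :: L) &&
            all (fun k => k.1 * s <= k.2) (u :: U).
Proof.
move=> l_gt0 u_gt0; rewrite all_cat => /andP[/allP L_ge0 /allP U_ge0].
move=> /allrelP leLU.
(* The witness is the largest quotient among the lower rows with positive coefficient; the row [l]
   guarantees that there is one. *)
pose r := [seq k.2 / k.1 | k <- L & 0 < k.1].
have [s s_in s_ge] := exists_max_mem (l.2 / l.1) r.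
have [k k_gt0 [k_in s_def]] : exists2 k, 0 < k.1 & k \in l :: L /\ s = k.2 / k.1.
  move: s_in; rewrite inE => /orP[/eqP->|/mapP[k]].
    by exists l; rewrite ?mem_head.
  by rewrite mem_filter => /andP[k_gt0 kL] ->; exists k; rewrite // inE kL orbT.
exists s; apply/andP; split; apply/allP => j j_in; last first.
  by rewrite s_def mulrA ler_pdivrMr // [j.2 * _]mulrC leLU.
have [j_gt0|j_le0] := ltP 0 j.1.
  rewrite mulrC -ler_pdivrMr //; apply: s_ge.
  move: j_in; rewrite !inE => /orP[/eqP->|jL]; rewrite ?eqxx //.
  by apply/orP; right; apply/mapP; exists j; rewrite // mem_filter j_gt0.
have j_eq0 : j.1 = 0.
  apply/eqP; rewrite eq_le j_le0; move: j_in; rewrite inE => /orP[/eqP->|/L_ge0//].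
  exact: ltW.
(* A lower row with coefficient 0 paired with [u] reads [u.1 * j.2 <= 0], so its bound is
   nonpositive and any [s] satisfies it. *)
by have := leLU _ _ j_in (mem_head u U); rewrite j_eq0 !mul0r pmulr_rle0.
Qed.

Lemma exists_between (R : realFieldType) (l u : R) (L U : seq R) :
    allrel <=%R (l :: L) (u :: U) ->
  exists t, all (<=%R^~ t) (l :: L) && all (<=%R t) (u :: U).
Proof.
move=> /allrelP leLU; have [t t_in t_ge] := exists_max_mem l L.
by exists t; apply/andP; split; apply/allP => y y_in /=; [apply: t_ge|apply: leLU].
Qed.

(** * Distribution of given generations over patterns of given weights *)

Lemma split_interval (R : realFieldType) (a k l x : R) :
  0 <= a * k -> 0 <= a * l -> 0 <= x <= a * (k + l) ->
  exists x', 0 <= x' <= a * k /\ 0 <= x - x' <= a * l.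
Proof.
move=> ak al /andP[x0 xkl].
have [|x'] := @exists_between R 0 (a * k) [:: x - a * l] [:: x].
  by rewrite /allrel /= !andbT; splits; lra.
rewrite /= !andbT => /andP[/andP[? ?] /andP[? ?]].
by exists x'; splits; lra.
Qed.

(* z and t are the middle generations of the two patterns, of weights c and s,
   that are on both in the middle period and in the end period considered. *)
Lemma split_end (R : realFieldType) (V a b p c s z t x : R) :
  0 <= V * c -> 0 <= V * s -> 0 <= a * p -> 0 <= b * s ->
  0 <= z -> 0 <= t <= b * s ->
  [/\ 0 <= x, z <= x + V * c, t <= x + V * s & z <= x + V * (c + s) - t] ->
  x - a * p - V * c - b * s <= z -> x - a * p - V * (c + s) - t <= z ->
  exists x' z' t', [/\ x = x' + z' + t', 0 <= x' <= a * p, 0 <= z',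
    z - V * c <= z' <= z + V * c
    & 0 <= t' <= b * s /\ t - V * s <= t' <= t + V * s].
Proof.
move=> Vc Vs ap bs z0 /andP[t0 tb] [x0 zx tx ztx] xz xt.
(* Besides its own range and its ramp to [t], [t'] receives the pairwise conditions left by
   eliminating [z'] from the constraints on [z'] and on the remainder [x - t' - z'] in
   [[0, a * p]]. *)
have [|t'] := @exists_between R 0 (b * s)
  [:: t - V * s; x - a * p - z - V * c] [:: t + V * s; x; x - z + V * c].
  by rewrite /allrel /= !andbT; splits; lra.
rewrite /= !andbT => /andP[/and3P[? ? ?] /and4P[? ? ? ?]].
have [|z'] := @exists_between R 0 (z + V * c)
  [:: z - V * c; x - t' - a * p] [:: x - t'].
  by rewrite /allrel /= !andbT; splits; lra.
rewrite /= !andbT => /andP[/and3P[? ? ?] /andP[? ?]].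
exists (x - t' - z'), z', t'; splits; lra.
Qed.

(* The patterns 110, 011, 111 and 010 have weights c, d, s and q; p is the
   total weight of 100 and 101, and e that of 001 and 101. *)
Definition in_pattern_sum (R : realFieldType) (V a b p e q c d s x1 x2 x3 : R) :=
  [/\ [/\ 0 <= x1, 0 <= x2 & 0 <= x3],
   [/\ x1 <= a * (p + c) + V * c + b * s,
     x2 <= a * (q + c + d) + b * s
     & x3 <= a * (e + d) + V * d + b * s],
   [/\ x1 - x2 <= a * p + V * (c + s),
     x2 - x1 <= a * (q + d) + V * (c + s),
     x2 - x3 <= a * (q + c) + V * (d + s)
     & x3 - x2 <= a * e + V * (d + s)],
     x1 - x3 <= a * (p + c) + V * (c + s + s) /\
     x3 - x1 <= a * (e + d) + V * (d + s + s)
   & x1 - x2 + x3 <= a * (p + e) + V * (c + d + s) + b * s /\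
     x2 - x1 - x3 <= a * q + V * (c + d + s)].

(* t, z and w are the middle generations of 111, 110 and 011; the remainder
   x2 - t - z - w is that of 010. *)
Lemma split_middle (R : realFieldType) (V a b p e q c d s x1 x2 x3 : R) :
  0 <= V -> V <= a -> a + V <= b ->
  [/\ 0 <= p, 0 <= e & 0 <= q] -> [/\ 0 <= c, 0 <= d & 0 <= s] ->
  in_pattern_sum V a b p e q c d s x1 x2 x3 ->
  exists t z w, [/\ 0 <= t <= b * s, 0 <= z <= a * c, 0 <= w <= a * d,
    x2 - a * q - t - z <= w <= x2 - t - z &
    [/\ z <= x1 + V * c, t <= x1 + V * s, z <= x1 + V * (c + s) - t,
       x1 - a * p - V * c - b * s <= z & x1 - a * p - V * (c + s) - t <= z] /\
    [/\ w <= x3 + V * d, t <= x3 + V * s, w <= x3 + V * (d + s) - t,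
       x3 - a * e - V * d - b * s <= w & x3 - a * e - V * (d + s) - t <= w]].
Proof.
move=> V0 Va ab [p0 e0 q0] [c0 d0 s0].
move=> [[x1_ge0 x2_ge0 x3_ge0] [x1_le x2_le x3_le] [d12 d21 d23 d32]].
move=> [d13 d31] [s132 s213].
have a0 : 0 <= a by lra.
have b0 : 0 <= b by lra.
have nn (k v w : R) : k <= w -> 0 <= v -> k * v <= w * v.
  by move=> *; apply: ler_wpM2r.
(* All later conditions are linear in the products of a coefficient and a weight. These products
   become independent quantities, related only by [0 <= V * k <= a * k] for every weight [k] and by
   [(a + V) * s <= b * s]. *)
have := (nn _ _ _ V0 p0, nn _ _ _ V0 e0, nn _ _ _ V0 q0).
have := (nn _ _ _ V0 c0, nn _ _ _ V0 d0, nn _ _ _ V0 s0).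
have := (nn _ _ _ Va p0, nn _ _ _ Va e0, nn _ _ _ Va q0).
have := (nn _ _ _ Va c0, nn _ _ _ Va d0, nn _ _ _ Va s0).
have := nn _ _ _ ab s0.
rewrite !mul0r => bs [[ac ad] as_] [[ap ae] aq] [[Vc Vd] Vs] [[Vp Ve] Vq].
clear nn V0 Va ab p0 e0 q0 c0 d0 s0 a0 b0.
(* The unknowns are eliminated in the order [w], [z], [t] and chosen in the reverse order, so the
   bounds for [t] are what remains after the other two are gone. *)
have [|t] := @exists_between R 0 (b * s)
  [:: x1 - a * p - V * (c + s) - a * c; x3 - a * e - V * (d + s) - a * d;
      (x1 - a * p - V * (c + s)) + (x3 - a * e - V * (d + s)) - x2;
      x2 - a * q - a * c - a * d; x2 - a * q - a * c - x3 - V * d;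
      x2 - a * q - a * d - x1 - V * c; x2 - a * q - x1 - x3 - V * c - V * d]
  [:: x1 + V * s; x3 + V * s; x2; x2 - (x1 - a * p - V * c - b * s);
      x2 - (x3 - a * e - V * d - b * s);
      x2 - (x1 - a * p - V * c - b * s) - (x3 - a * e - V * d - b * s);
      x1 + V * (c + s) + x3 + V * (d + s) - x2 + a * q].
  by rewrite /allrel /= !andbT; splits; lra.
rewrite /= !andbT => /andP[/and5P[t_ge0 ? t_ge3 ? /and4P[? ? ? ?]]].
move=> /and5P[t_le t_les1 t_les3 t_le2 /and4P[? ? ? ?]].
clear x2_le d13 d31 s132 s213.
have [|z] := @exists_between R 0 (a * c)
  [:: x1 - a * p - V * c - b * s; x1 - a * p - V * (c + s) - t;
     x2 - a * q - t - a * d; x2 - a * q - t - x3 - V * d;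
     x2 - a * q - x3 - V * (d + s)]
  [:: x1 + V * c; x1 + V * (c + s) - t; x2 - t;
     x2 - t - (x3 - a * e - V * d - b * s); x2 - (x3 - a * e - V * (d + s))].
  by rewrite /allrel /= !andbT; splits; lra.
rewrite /= !andbT => /andP[/and5P[z_ge0 ? ? z_ged /andP[z_ge3 z_ge3t]]].
move=> /and5P[? ? ? z_le2 /andP[z_le3 z_le3t]].
have [|w] := @exists_between R 0 (a * d)
  [:: x3 - a * e - V * d - b * s; x3 - a * e - V * (d + s) - t;
     x2 - a * q - t - z]
  [:: x3 + V * d; x3 + V * (d + s) - t; x2 - t - z].
  clear -bs ac ad as_ ap ae aq Vc Vd Vs Vp Ve Vq x3_ge0 x3_le t_ge0 t_ge3 t_le t_les3
    z_ge0 z_ged z_ge3 z_ge3t z_le2 z_le3 z_le3t.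
  by rewrite /allrel /= !andbT; splits; lra.
rewrite /= !andbT => /andP[/and4P[? ? ? ?] /and4P[? ? ? ?]].
by exists t, z, w; splits.
Qed.

(** * Choice of the weight [s] of 111 *)

Lemma le_of_weighted (R : realFieldType) (al be g m x : R) :
  0 <= al -> 0 <= be -> 0 <= x -> g <= be * m ->
  (al + be) * g <= be * x -> g <= x.
Proof.
move=> al0 be0 x0 gm gx.
(* No division is possible when the total coefficient is 0; then [be = 0] and [g <= be * m] gives
   [g <= 0 <= x]. *)
have [k0|k_neq0] := eqVneq (al + be) 0.
  have be_eq0 : be = 0 by lra.
  by rewrite be_eq0 mul0r in gm; lra.
have k_gt0 : 0 < al + be by rewrite lt_neqAle eq_sym k_neq0 addr_ge0.
rewrite -(ler_pM2l k_gt0); apply: (le_trans gx); rewrite mulrDl.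
by rewrite lerDr mulr_ge0.
Qed.

(** This is the compatibility of a lower row [w <= k * s] with the upper row [al * s <= x - g]. For
    [w <= 0] it follows from [g <= x]; otherwise the two bounds on [w] are combined with weights
    chosen so that [x] can be compared with [x - g]. *)
Lemma le_weighted_gap (R : realFieldType) (al be k g m n w x : R) :
  0 <= al -> 0 <= be -> be <= k -> 0 <= x -> g <= be * m ->
  (al + be) * g <= be * x -> w <= k * n -> w + al * n <= x ->
  al * w <= k * (x - g).
Proof.
move=> al0 be0 bek x0 gm gx wn wx.
have k0 : 0 <= k by lra.
have g_le := le_of_weighted al0 be0 x0 gm gx.
have [w0|w0] := lerP w 0.
  apply: (@le_trans _ _ 0); first by rewrite mulr_ge0_le0.
  by rewrite mulr_ge0 // subr_ge0.
have [k_eq0|k_neq0] := eqVneq (al + be) 0.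
  have -> : al = 0 by lra.
  by rewrite mul0r mulr_ge0 // subr_ge0.
have k_gt0 : 0 < al + be by rewrite lt_neqAle eq_sym k_neq0 addr_ge0.
rewrite -(ler_pM2l k_gt0).
(* (al + be) (x - g) >= al x >= al (w + al n), and k n >= w *)
have H1 : k * (al * x) <= k * ((al + be) * (x - g)) by apply: ler_wpM2l => //; lra.
have H2 : (k * al) * (w + al * n) <= (k * al) * x by apply: ler_wpM2l; rewrite ?mulr_ge0.
have H3 : (al * al) * w <= (al * al) * (k * n) by apply: ler_wpM2l; rewrite ?mulr_ge0.
have H4 : (al * w) * be <= (al * w) * k by apply: ler_wpM2l; rewrite ?mulr_ge0 // ltW.
lra.
Qed.

(* Here u = u2, e = u3, m = y2 - u2, n = y3 - u3 and p = y1 - m. *)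
Lemma exists_weight (R : realFieldType) (V a b p e u m n x1 x2 x3 : R) :
  0 <= V -> V <= a -> a + V <= b ->
  [/\ 0 <= p, 0 <= e & 0 <= u] -> [/\ 0 <= m, 0 <= n & n <= u + m] ->
  [/\ 0 <= x1, 0 <= x2 & 0 <= x3] ->
  [/\ x1 <= a * p + b * m,
      x1 <= a * (p + m) + V * m + (b - a - V) * n,
      x2 <= a * u + b * m & x2 <= a * (u + m) + (b - a) * n] ->
  x3 <= a * e + b * n -> x3 <= a * (e + n) + V * n + (b - a - V) * m ->
  [/\ x2 - x1 <= V * m + a * u, x3 - x2 <= V * n + a * e,
      x1 - x2 <= a * p + V * m & x2 - x3 <= a * (u + m) - (a - V) * n] ->
  x1 - x3 <= a * (p + m) + V * m + (a - V) * (u - n) ->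
  x3 - x1 <= a * e + (V + V) * n + (a - V) * u ->
  (b - V - V) * (x1 - a * (p + m) - V * m) <= (b - a - V) * x3 ->
  (b - V - V) * (x3 - a * (e + n) - V * n) <= (b - a - V) * x1 ->
  exists s, [/\ 0 <= s, n - u <= s, s <= m & s <= n] /\
    in_pattern_sum V a b p e (u - n + s) (m - s) (n - s) s x1 x2 x3.
Proof.
move=> V0 Va ab [p0 e0 u0] [m0 n0 num] [x1_ge0 x2_ge0 x3_ge0].
move=> [x1_le x1_le' x2_le x2_le'] x3_le x3_le' [d21 d32 d12 d23] d13 d31 w1 w3.
(* In terms of the slacks [al] and [be] the coefficients [b - V - V] and [b - a - V] become
   [al + be] and [be], visibly nonnegative. *)
have [al [alE al0]] : exists al, al = a - V /\ 0 <= al by exists (a - V); lra.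
have [be [beE be0]] : exists be, be = b - a - V /\ 0 <= be by exists (b - a - V); lra.
move: x1_le x1_le' x2_le x2_le' x3_le x3_le' d21 d32 d12 d23 d13 d31 w1 w3.
rewrite -alE -beE; have -> : b = a + V + be by lra.
clear b ab beE; have {alE Va} -> : a = V + al by lra.
move=> x1_le x1_le' x2_le x2_le' x3_le x3_le' d21 d32 d12 d23 d13 d31 w1 w3.
(* The capacity of period 1 reads [g1 <= be * s], and the ramp from period 1 to period 3 reads
   [al * s <= x3 - g1]; their pairing is [w1']. The same holds for [g3] with the end periods
   exchanged. *)
pose g1 := x1 - (V + al) * (p + m) - V * m.
pose g3 := x3 - (V + al) * (e + n) - V * n.
have g1E : g1 = x1 - (V + al) * (p + m) - V * m by [].
have g3E : g3 = x3 - (V + al) * (e + n) - V * n by [].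
have w1' : (al + be) * g1 <= be * x3 by rewrite g1E; clear -w1; lra.
have w3' : (al + be) * g3 <= be * x1 by rewrite g3E; clear -w3; lra.
clear w1 w3; clearbody g1 g3.
have [Vp Ve Vm Vn] : [/\ 0 <= V * p, 0 <= V * e, 0 <= V * m & 0 <= V * n].
  by split; apply: mulr_ge0.
have [ap ae am an] : [/\ 0 <= al * p, 0 <= al * e, 0 <= al * m & 0 <= al * n].
  by split; apply: mulr_ge0.
have g1m : g1 <= be * m by clear -g1E x1_le; lra.
have g1n : g1 <= be * n by clear -g1E x1_le'; lra.
have g3m : g3 <= be * m by clear -g3E x3_le'; lra.
have g3n : g3 <= be * n by clear -g3E x3_le; lra.
have g1x := le_of_weighted al0 be0 x3_ge0 g1m w1'.
have g3x := le_of_weighted al0 be0 x1_ge0 g3n w3'.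
have beV : be <= V + be by rewrite lerDr.
(* The pairings of the other lower rows with the two ramp rows are not among the listed inequalities
   and have to be derived from them. *)
have g13 : al * g3 <= be * (x3 - g1).
  apply: (le_weighted_gap _ _ _ _ g1m w1' g3n) => //.
  by clear -g3E ae Ve Vn; lra.
have g31 : al * g1 <= be * (x1 - g3).
  apply: (le_weighted_gap _ _ _ _ g3n w3' g1m) => //.
  by clear -g1E ap Vp Vm; lra.
have g21 : al * (x2 - (V + al) * (u + m)) <= (V + be) * (x3 - g1).
  apply: (le_weighted_gap (n := n) _ _ _ _ g1m w1') => //.
    by clear -x2_le'; lra.
  by clear -d23; lra.
have g23 : al * (x2 - (V + al) * (u + m)) <= (V + be) * (x1 - g3).
  apply: (le_weighted_gap (n := m) _ _ _ _ g3n w3') => //.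
    by clear -x2_le; lra.
  by clear -d21 Vm; lra.
have g41 : al * (x1 - x2 + x3 - (V + al) * (p + e) - V * (m + n))
    <= (V + al + be) * (x3 - g1).
  have := ler_wpM2l V0 g1x.
  have : al * (x1 - x2 + x3 - (V + al) * (p + e) - V * (m + n)) <= al * x3.
    by apply: ler_wpM2l => //; clear -d12 Ve Vn ae; lra.
  by clear -w1'; lra.
have g43 : al * (x1 - x2 + x3 - (V + al) * (p + e) - V * (m + n))
    <= (V + al + be) * (x1 - g3).
  have := ler_wpM2l V0 g3x.
  have : al * (x1 - x2 + x3 - (V + al) * (p + e) - V * (m + n)) <= al * x1.
    by apply: ler_wpM2l => //; clear -d32 Vp Vm ap; lra.
  by clear -w3'; lra.
have g61 : al * (x2 - x1 - x3 - V * (u + m) - al * (u - n)) <= al * (x3 - g1).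
  by apply: ler_wpM2l => //; clear -g1E d23 x3_ge0 Vp Vm ap am; lra.
have g63 : al * (x2 - x1 - x3 - V * (u + m) - al * (u - n)) <= al * (x1 - g3).
  by apply: ler_wpM2l => //; clear -g3E d21 x1_ge0 Ve Vn Vm ae an; lra.
(* These are the bounds on [s] and the rows of [in_pattern_sum] that still depend on [s] after
   substituting the weights; the ramps between consecutive periods do not. *)
have [||||s] := @exists_scaled_between R (1, 0) (1, m)
  [:: (1, n - u); (be, g1); (be, g3);
    (V + al + be, x1 - x2 + x3 - (V + al) * (p + e) - V * (m + n));
    (V + be, x2 - (V + al) * (u + m));
    (al, x2 - x1 - x3 - V * (u + m) - al * (u - n))]
  [:: (1, n); (al, x3 - g1); (al, x1 - g3)].
- exact: ltr01.
- exact: ltr01.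
- by rewrite /= !andbT; splits; rewrite ?addr_ge0 ?ler01.
- by rewrite /allrel /= !andbT; splits; rewrite ?mul1r ?mul0r ?mulr0 ?subr_ge0 //;
    clear -u0 w1' w3' g1E g3E d12 d21 d23 d32 d13 d31 x1_ge0 x3_ge0 x1_le x2_le x2_le'
      x3_le num; lra.
rewrite /= !andbT !mul1r => /andP[/and5P[s0 sn g1s g3s /and3P[s4 s5 s6]]].
move=> /and4P[sm sn' t1 t3].
clear -x1_ge0 x2_ge0 x3_ge0 d12 d21 d23 d32 g1E g3E s0 sn g1s g3s s4 s5 s6 sm sn' t1 t3.
by exists s; split; last split; splits; lra.
Qed.

(** * Convexity expressed through dilates *)

Lemma convex_setP (R : realFieldType) (M : lmodType R) (A : set M) :
  @convex_set R M A <->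
  forall x y t, 0 <= t -> t <= 1 -> A x -> A y -> A (t *: x + (1 - t) *: y).
Proof.
split=> [cA x y t t0 t1 Ax Ay|cA x y t].
  by have := cA x y (Itv01 t0 t1) (mem_set Ax) (mem_set Ay); rewrite inE.
by rewrite !inE => Ax Ay; apply: cA; rewrite ?ge0 ?le1.
Qed.

(* w lies in the dilate l A; for l = 0 this forces w = 0 and A nonempty. *)
Definition scaled (R : realFieldType) (M : lmodType R) (A : set M) (l : R) (w : M) :=
  0 <= l /\ exists2 v, A v & w = l *: v.

Lemma scaledS (R : realFieldType) (M : lmodType R) (A B : set M) (l : R) (w : M) :
  A `<=` B -> scaled A l w -> scaled B l w.
Proof. by move=> AB [l0 [v Av ->]]; split=> //; exists v; first exact: AB. Qed.

(** The representatives are averaged with weights [k / (k + l)] and [l / (k + l)]; if [k + l = 0],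
    both vectors vanish. Points of patterns can thus be added without normalising their weights
    first. *)
Lemma scaledD (R : realFieldType) (M : lmodType R) (A : set M) (k l : R) (v w : M) :
  @convex_set R M A -> scaled A k v -> scaled A l w -> scaled A (k + l) (v + w).
Proof.
move=> /convex_setP cA [k0 [v' Av' ->]] [l0 [w' Aw' ->]]; split; first exact: addr_ge0.
have [kl0|kl0] := eqVneq (k + l) 0.
  have [-> ->] : k = 0 /\ l = 0 by lra.
  by exists v'; rewrite // !(scale0r, addr0).
have kl_gt0 : 0 < k + l by rewrite lt_neqAle eq_sym kl0 addr_ge0.
exists (k / (k + l) *: v' + (1 - k / (k + l)) *: w').
  by apply: cA; rewrite ?divr_ge0 ?ler_pdivrMr ?mul1r ?lerDl // ltW.
rewrite scalerDr !scalerA mulrBr mulr1 mulrCA divff // mulr1.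
by rewrite [k + l - k]addrAC subrr add0r.
Qed.

(** * Schedules with three periods in coordinates *)

Definition sched3 (R : realType) (x1 x2 x3 y1 y2 y3 u2 u3 : R) : schedule R 3 :=
  (\row_(i < 3) [:: x1; x2; x3]`_i, \row_(i < 3) [:: y1; y2; y3]`_i,
   \row_(i < 2) [:: u2; u3]`_i).

Lemma sched3K (R : realType) (x1 x2 x3 y1 y2 y3 u2 u3 : R)
    (z := sched3 x1 x2 x3 y1 y2 y3 u2 u3) :
  (((gen z 1 = x1) * (gen z 2 = x2) * (gen z 3 = x3)) *
   ((online z 1 = y1) * (online z 2 = y2) * (online z 3 = y3)) *
   ((startup z 2 = u2) * (startup z 3 = u3)))%type.
Proof.
by do !split; rewrite /gen /online /startup /entry_from; case: insubP => //= i _ hi;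
  rewrite mxE hi.
Qed.

Lemma sched3_eta (R : realType) (z : schedule R 3) :
  z = sched3 (gen z 1) (gen z 2) (gen z 3) (online z 1) (online z 2) (online z 3)
    (startup z 2) (startup z 3).
Proof.
case: z => [[x y] u]; rewrite /gen /online /startup /entry_from /=.
congr (_, _, _); apply/rowP => -[[|[|[|i]]] hi] //;
  rewrite mxE /= insubT //=; congr (_ _ _); exact: val_inj.
Qed.

Lemma sched3D (R : realType) (x1 x2 x3 y1 y2 y3 u2 u3 : R)
    (x1' x2' x3' y1' y2' y3' u2' u3' : R) :
  sched3 x1 x2 x3 y1 y2 y3 u2 u3 + sched3 x1' x2' x3' y1' y2' y3' u2' u3' =
  sched3 (x1 + x1') (x2 + x2') (x3 + x3') (y1 + y1') (y2 + y2') (y3 + y3')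
    (u2 + u2') (u3 + u3').
Proof.
by congr (_, _, _); apply/rowP => -[[|[|[|i]]] hi] //; rewrite !mxE.
Qed.

Lemma sched3Z (R : realType) (k x1 x2 x3 y1 y2 y3 u2 u3 : R) :
  k *: sched3 x1 x2 x3 y1 y2 y3 u2 u3 =
  sched3 (k * x1) (k * x2) (k * x3) (k * y1) (k * y2) (k * y3) (k * u2) (k * u3).
Proof.
by congr (_, _, _); apply/rowP => -[[|[|[|i]]] hi] //; rewrite !mxE.
Qed.

Lemma commitment_set3P (R : realType) (Cl Cu Vbar V x1 x2 x3 y1 y2 y3 u2 u3 : R) :
  commitment_set 3 1 1 Cl Cu Vbar V (sched3 x1 x2 x3 y1 y2 y3 u2 u3) <->
  [/\ [/\ 0 <= x1, 0 <= x2 & 0 <= x3],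
      [/\ y1 = 0 \/ y1 = 1, y2 = 0 \/ y2 = 1 & y3 = 0 \/ y3 = 1] /\
      ((u2 = 0 \/ u2 = 1) /\ (u3 = 0 \/ u3 = 1)),
      [/\ u2 <= y2, u3 <= y3, u2 <= 1 - y1 & u3 <= 1 - y2] /\
      (y2 - y1 - u2 <= 0 /\ y3 - y2 - u3 <= 0),
      [/\ Cl * y1 <= x1 <= Cu * y1, Cl * y2 <= x2 <= Cu * y2
        & Cl * y3 <= x3 <= Cu * y3]
    & [/\ x2 - x1 <= V * y1 + Vbar * (1 - y1), x3 - x2 <= V * y2 + Vbar * (1 - y2),
          x1 - x2 <= V * y2 + Vbar * (1 - y2) & x2 - x3 <= V * y3 + Vbar * (1 - y3)]].
Proof.
set z := sched3 _ _ _ _ _ _ _ _.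
(* For [L = l = 1] the minimum-up and minimum-down sums run over the single index [t]. *)
have sum2 : \sum_(2 - 1 + 1 <= i < 3) startup z i = u2 by rewrite big_nat1 sched3K.
have sum3 : \sum_(3 - 1 + 1 <= i < 4) startup z i = u3 by rewrite big_nat1 sched3K.
split=> [[Hx [Hy [Hu [HL [Hl [Ht [HC [HV HW]]]]]]]]|].
  have := (Hx 1 isT, Hx 2 isT, Hx 3 isT, Hy 1 isT, Hy 2 isT, Hy 3 isT).
  have := (Hu 2 isT, Hu 3 isT, HL 2 isT, HL 3 isT, Hl 2 isT, Hl 3 isT).
  have := (Ht 2 isT, Ht 3 isT, HC 1 isT, HC 2 isT, HC 3 isT).
  have := (HV 2 isT, HV 3 isT, HW 2 isT, HW 3 isT).
  rewrite sum2 sum3 !sched3K.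
  by move=> [[[? ?] ?] ?] [[[[? ?] ?] ?] ?] [[[[[? ?] ?] ?] ?] ?] [[[[[? ?] ?] ?] ?] ?].
move=> [[? ? ?] [[? ? ?] [? ?]] [[? ? ? ?] [? ?]] [? ? ?] [? ? ? ?]].
by do ?apply: conj; case=> [|[|[|[|t]]]] // _; rewrite ?sum2 ?sum3 !sched3K.
Qed.

(** For a fixed pattern the constraints are homogenised by the weight [l], and start-ups occur
    exactly where off is followed by on. Dividing by [l] gives a point of P; for [l = 0] the
    generations vanish and the zero schedule serves. *)
Lemma scaled_pattern (R : realType) (Cl Cu Vbar V l x1 x2 x3 : R) (b1 b2 b3 : bool) :
  0 <= Cl -> 0 <= Vbar -> 0 <= l ->
  let y b := if b then l else 0 in
  [/\ Cl * y b1 <= x1 <= Cu * y b1, Cl * y b2 <= x2 <= Cu * y b2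
    & Cl * y b3 <= x3 <= Cu * y b3] ->
  [/\ x2 - x1 <= V * y b1 + Vbar * (l - y b1),
      x3 - x2 <= V * y b2 + Vbar * (l - y b2),
      x1 - x2 <= V * y b2 + Vbar * (l - y b2)
    & x2 - x3 <= V * y b3 + Vbar * (l - y b3)] ->
  scaled (commitment_set 3 1 1 Cl Cu Vbar V) l
    (sched3 x1 x2 x3 (y b1) (y b2) (y b3) (y (~~ b1 && b2)) (y (~~ b2 && b3))).
Proof.
move=> Cl0 Vbar0 l0 y.
have {y} -> : y = fun b : bool => l * b%:R.
  by apply/funext => -[]; rewrite /y ?mulr1 ?mulr0.
move=> Hx Hr; split=> //.
have [l_eq0|l_neq0] := eqVneq l 0.
  move: Hx; rewrite /= l_eq0 !mul0r !mulr0 => -[x1E x2E x3E].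
  exists (sched3 0 0 0 0 0 0 0 0); last first.
    by rewrite sched3Z !mul0r; congr (sched3 _ _ _ _ _ _ _ _); lra.
  by apply/commitment_set3P; splits; first [by left | clear -Vbar0; lra].
have l_gt0 : 0 < l by rewrite lt_neqAle eq_sym l_neq0.
have divl x : exists v, x = l * v by exists (l^-1 * x); rewrite mulVKf.
have [[v1 v1E] [[v2 v2E] [v3 v3E]]] := (divl x1, (divl x2, divl x3)).
move: Hx Hr; rewrite /= {}v1E {}v2E {}v3E => -[x1_bd x2_bd x3_bd] [r21 r32 r12 r23].
exists (sched3 v1 v2 v3 b1%:R b2%:R b3%:R (~~ b1 && b2)%:R (~~ b2 && b3)%:R); last first.
  by rewrite sched3Z.
have Clb (b : bool) : 0 <= Cl * (l * b%:R) by rewrite !mulr_ge0.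
have [Clb1 Clb2 Clb3] := And3 (Clb b1) (Clb b2) (Clb b3).
apply/commitment_set3P; split.
- by split; rewrite -(ler_pM2l l_gt0); lra.
- by case: b1 b2 b3 {x1_bd x2_bd x3_bd r21 r32 r12 r23 Clb1 Clb2 Clb3} => -[] -[];
    splits; first [by left | by right].
- by case: b1 b2 b3 {x1_bd x2_bd x3_bd r21 r32 r12 r23 Clb1 Clb2 Clb3} => -[] -[] /=;
    splits; lra.
- by splits; rewrite -(ler_pM2l l_gt0); lra.
- by splits; rewrite -(ler_pM2l l_gt0); lra.
Qed.

(** * The listed inequalities define a convex set containing P *)

Lemma ler_conv (R : realFieldType) (t a b c d : R) :
  0 <= t -> t <= 1 -> a <= b -> c <= d -> t * a + (1 - t) * c <= t * b + (1 - t) * d.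
Proof. by move=> t0 t1 ab cd; apply: lerD; apply: ler_wpM2l; rewrite ?subr_ge0. Qed.

(** Iterated along a long conjunction, this treats each affine inequality of [hull3] separately. *)
Lemma and_map2 (A A' B B' C C' : Prop) :
  (A -> B -> C) -> (A' -> B' -> C') -> A /\ A' -> B /\ B' -> C /\ C'.
Proof. by move=> f g [? ?] [? ?]; split; [apply: f|apply: g]. Qed.

Definition hull3 (R : realType) (Cl Cu Vbar V : R) : set (schedule R 3) :=
  [set z : schedule R 3 |
    let x1 := gen z 1 in let x2 := gen z 2 in let x3 := gen z 3 in
    let y1 := online z 1 in let y2 := online z 2 in let y3 := online z 3 in
    let u2 := startup z 2 in let u3 := startup z 3 in
    y2 - y1 <= u2 /\ y3 - y2 <= u3 /\ 0 <= u2 /\ 0 <= u3 /\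
    Cl * y1 <= x1 /\ Cl * y2 <= x2 /\ Cl * y3 <= x3 /\
    u2 <= y2 /\ u3 <= y3 /\ y1 + u2 <= 1 /\ y2 + u3 <= 1 /\
    x1 <= Vbar * y1 + (Cu - Vbar) * (y2 - u2) /\
    x1 <= Vbar * y1 + V * (y2 - u2) + (Cu - Vbar - V) * (y3 - u3) /\
    x2 <= Cu * y2 - (Cu - Vbar) * u2 /\
    x2 <= Vbar * y2 + (Cu - Vbar) * (y3 - u3) /\
    x3 <= Cu * y3 - (Cu - Vbar) * u3 /\
    x3 <= (Vbar + V) * y3 - V * u3 + (Cu - Vbar - V) * (y2 - u2) /\
    x2 - x1 <= (Cl + V) * y2 - Cl * y1 - (Cl + V - Vbar) * u2 /\
    x3 - x2 <= (Cl + V) * y3 - Cl * y2 - (Cl + V - Vbar) * u3 /\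
    x1 - x2 <= Vbar * y1 - (Vbar - V) * y2 - (Cl + V - Vbar) * u2 /\
    x2 - x3 <= Vbar * y2 - (Vbar - V) * y3 - (Cl + V - Vbar) * u3 /\
    x1 - x3 <= Vbar * y1 - Cl * y3 + V * (y2 - u2)
               + (Cl + V - Vbar) * (y3 - u3 - u2) /\
    x3 - x1 <= (Cl + 2 * V) * y3 - Cl * y1 - (Cl + 2 * V - Vbar) * u3
               - (Cl + V - Vbar) * u2 /\
    (Cu - Cl - 2 * V) * (x1 - Vbar * y1 - V * (y2 - u2))
      <= (Cu - Vbar - V) * (x3 - Cl * y3) /\
    (Cu - Cl - 2 * V) * (x3 - (Vbar + V) * y3 + V * u3)
      <= (Cu - Vbar - V) * (x1 - Cl * y1)].

Lemma convex_hull3 (R : realType) (Cl Cu Vbar V : R) :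
  @convex_set R (schedule R 3) (hull3 Cl Cu Vbar V).
Proof.
apply/convex_setP => z z' t t0 t1; rewrite (sched3_eta z) (sched3_eta z').
move: (gen z 1) (gen z 2) (gen z 3) (online z 1) (online z 2) (online z 3)
  (startup z 2) (startup z 3) => x1 x2 x3 y1 y2 y3 u2 u3.
move: (gen z' 1) (gen z' 2) (gen z' 3) (online z' 1) (online z' 2) (online z' 3)
  (startup z' 2) (startup z' 3) => x1' x2' x3' y1' y2' y3' u2' u3'.
rewrite !sched3Z sched3D /hull3 /= !sched3K; move: t0 t1; clear z z' => t0 t1.
by do ?apply: and_map2; move=> h h'; have := ler_conv t0 t1 h h';
  clear h h'; lra.
Qed.

(** In the sum of [al * g <= al * be] and [be * g <= be * (x - al)] the term [al * be] cancels. *)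
Lemma weighted_le (R : realFieldType) (al be g x : R) :
  0 <= al -> 0 <= be -> g <= be -> g <= x - al -> (al + be) * g <= be * x.
Proof.
move=> al0 be0 gb gx.
have := ler_wpM2l al0 gb; have := ler_wpM2l be0 gx; lra.
Qed.

Lemma commitment_set_hull3 (R : realType) (Cl Cu Vbar V : R) :
  0 < V -> Cl + V <= Vbar -> 0 <= Cu - Vbar - V ->
  commitment_set 3 1 1 Cl Cu Vbar V `<=` hull3 Cl Cu Vbar V.
Proof.
move=> V0 ClV Cub z; rewrite (sched3_eta z).
move: (gen z 1) (gen z 2) (gen z 3) (online z 1) (online z 2) (online z 3)
  (startup z 2) (startup z 3) => x1 x2 x3 y1 y2 y3 u2 u3.
move=> /commitment_set3P; rewrite /hull3 /= !sched3K.
move=> [[x1_ge0 x2_ge0 x3_ge0] [[y1E y2E y3E] [u2E u3E]]].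
move=> [[u2y2 u3y3 u2y1 u3y2] [yu2 yu3]].
move=> [/andP[x1_ge x1_le] /andP[x2_ge x2_le] /andP[x3_ge x3_le]] [r21 r32 r12 r23].
have u2_eq : u2 = (1 - y1) * y2.
  by clear -y1E y2E u2E u2y2 u2y1 yu2; case: y1E y2E u2E => y1E [] y2E [] u2E;
    rewrite y1E y2E; lra.
have u3_eq : u3 = (1 - y2) * y3.
  by clear -y2E y3E u3E u3y3 u3y2 yu3; case: y2E y3E u3E => y2E [] y3E [] u3E;
    rewrite y2E y3E; lra.
(* This handles the two inequalities with product coefficients. The signs suffice except for the
   pattern 111, where the capacity of one end period and the ramp between the end periods supply the
   second alternative. *)
have w (g x : R) : g <= 0 /\ 0 <= x \/ g <= Cu - Vbar - V /\ g <= x - (Vbar - Cl - V) ->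
    (Cu - Cl - 2 * V) * g <= (Cu - Vbar - V) * x.
  clear -ClV Cub; have -> : Cu - Cl - 2 * V = (Vbar - Cl - V) + (Cu - Vbar - V) by lra.
  case=> [[g0 x0]|[gb gx]]; last by apply: weighted_le; lra.
  by apply: (@le_trans _ _ 0); [rewrite mulr_ge0_le0 // addr_ge0 //; lra|rewrite mulr_ge0].
rewrite {}u2_eq {}u3_eq; clear u2E u3E u2y2 u3y3 u2y1 u3y2 yu2 yu3.
case: y1E => y1E; case: y2E => y2E; case: y3E => y3E; subst y1 y2 y3.
all: clear -V0 ClV Cub x1_ge x1_le x2_ge x2_le x3_ge x3_le r21 r32 r12 r23 w.
all: do ?[apply: conj]; first [done | clear; lra | lra |
  apply: w; first [by left; split; lra | by right; split; lra]].
Qed.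

(** * Decomposition of a point of [hull3] into the eight patterns *)

Lemma hull3_sub (R : realType) (Cl Cu Vbar V : R) (B : set (schedule R 3)) :
  0 <= Cl -> 0 < V -> Cl + V <= Vbar -> 0 <= Cu - Vbar - V ->
  @convex_set R (schedule R 3) B ->
  commitment_set 3 1 1 Cl Cu Vbar V `<=` B -> hull3 Cl Cu Vbar V `<=` B.
Proof.
move=> Cl0 V0 ClV Cub cB PB z; rewrite (sched3_eta z).
move: (gen z 1) (gen z 2) (gen z 3) (online z 1) (online z 2) (online z 3)
  (startup z 2) (startup z 3) => x1 x2 x3 y1 y2 y3 u2 u3.
rewrite /hull3 /= !sched3K.
move=> [yu2 [yu3 [u2_ge0 [u3_ge0 [x1_ge [x2_ge [x3_ge [uy2 [uy3 [yu1 [yu2' H]]]]]]]]]]].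
have [a aE] : exists a, Vbar = Cl + a by exists (Vbar - Cl); rewrite subrKC.
have [b bE] : exists b, Cu = Cl + b by exists (Cu - Cl); rewrite subrKC.
have [m mE] : exists m, y2 = u2 + m by exists (y2 - u2); rewrite subrKC.
have [n nE] : exists n, y3 = u3 + n by exists (y3 - u3); rewrite subrKC.
have [p pE] : exists p, y1 = p + m by exists (y1 - m); rewrite subrK.
have [X1 X1E] : exists X, x1 = X + Cl * y1 by exists (x1 - Cl * y1); rewrite subrK.
have [X2 X2E] : exists X, x2 = X + Cl * y2 by exists (x2 - Cl * y2); rewrite subrK.
have [X3 X3E] : exists X, x3 = X + Cl * y3 by exists (x3 - Cl * y3); rewrite subrK.
subst.
move: H => [H1 [H2 [H3 [H4 [H5 [H6 [H7 [H8 [H9 [H10 [H11 [H12 [H13 H14]]]]]]]]]]]]].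
have V_ge0 := ltW V0.
have Va : V <= a by clear -ClV; lra.
have ab : a + V <= b by clear -Cub; lra.
have p0 : 0 <= p by clear -yu2; lra.
have m0 : 0 <= m by clear -uy2; lra.
have n0 : 0 <= n by clear -uy3; lra.
have num : n <= u2 + m by clear -yu3; lra.
have X1_ge0 : 0 <= X1 by clear -x1_ge; lra.
have X2_ge0 : 0 <= X2 by clear -x2_ge; lra.
have X3_ge0 : 0 <= X3 by clear -x3_ge; lra.
have [||||||||s [[s0 sn sm sn'] Hs]] := @exists_weight R V a b p u3 u2 m n X1 X2 X3
  V_ge0 Va ab (And3 p0 u3_ge0 u2_ge0) (And3 m0 n0 num) (And3 X1_ge0 X2_ge0 X3_ge0).
- by split; [clear -H1|clear -H2|clear -H3|clear -H4]; lra.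
- by clear -H5; lra.
- by clear -H6; lra.
- by split; [clear -H7|clear -H8|clear -H9|clear -H10]; lra.
- by clear -H11; lra.
- by clear -H12; lra.
- by clear -H13; lra.
- by clear -H14; lra.
clear H1 H2 H3 H4 H5 H6 H7 H8 H9 H10 H11 H12 H13 H14 x1_ge x2_ge x3_ge uy2 uy3 yu2 yu3.
have a0 : 0 <= a by clear -V_ge0 Va; lra.
have b0 : 0 <= b by clear -a0 V_ge0 ab; lra.
have [c0 d0 q0] : [/\ 0 <= m - s, 0 <= n - s & 0 <= u2 - n + s].
  by clear -sm sn' sn; split; lra.
have [t [z' [w [tb zb wb wzt [t1 t3]]]]] := split_middle V_ge0 Va ab
  (And3 p0 u3_ge0 q0) (And3 c0 d0 s0) Hs.
have /andP[z0 _] := zb; have /andP[w0 _] := wb.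
have [Vc Vd Vs] : [/\ 0 <= V * (m - s), 0 <= V * (n - s) & 0 <= V * s].
  by split; apply: mulr_ge0.
have [ap ae bs] : [/\ 0 <= a * p, 0 <= a * u3 & 0 <= b * s].
  by split; apply: mulr_ge0.
move: t1 t3 => [z1 z2 z3 z4 z5] [w1 w2 w3 w4 w5].
have [h1 [z1' [t1' [X1E h1b z1b z1z [t1b t1t]]]]] :=
  split_end Vc Vs ap bs z0 tb (And4 X1_ge0 z1 z2 z3) z4 z5.
have [h3 [w3' [t3' [X3E h3b w3b w3w [t3b t3t]]]]] :=
  split_end Vd Vs ae bs w0 tb (And4 X3_ge0 w1 w2 w3) w4 w5.
(* The upper bounds keep the weights [p - r] of 100 and [u3 - r] of 001 nonnegative, the second
   lower bound that of 000. They are compatible because [y1 + u2 <= 1] and [y2 + u3 <= 1]. *)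
have [|r] := @exists_between R 0 p [:: p + m + u2 + u3 - 1] [:: u3].
  by rewrite /allrel /= !andbT; clear -p0 u3_ge0 yu1 yu2'; splits; lra.
rewrite /= !andbT => /andP[/andP[r0 r_ge] /andP[rp ru]].
have pr0 : 0 <= p - r by rewrite subr_ge0.
have er0 : 0 <= u3 - r by rewrite subr_ge0.
have [h1' [h1p h1r]] : exists x, 0 <= x <= a * (p - r) /\ 0 <= h1 - x <= a * r.
  by apply: split_interval; rewrite ?mulr_ge0 ?subrK.
have [h3' [h3p h3r]] : exists x, 0 <= x <= a * (u3 - r) /\ 0 <= h3 - x <= a * r.
  by apply: split_interval; rewrite ?mulr_ge0 ?subrK.
have Vbar0 : 0 <= Cl + a by rewrite addr_ge0.
have P111 : scaled B s
    (sched3 (t1' + Cl * s) (t + Cl * s) (t3' + Cl * s) s s s 0 0).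
  apply: (scaledS PB).
  by apply: (@scaled_pattern _ _ _ _ _ _ _ _ _ true true true) => //;
    clear -tb t1b t3b t1t t3t;
    rewrite /= ?(subrr, mulr0, addr0); splits; lra.
have P110 : scaled B (m - s)
    (sched3 (z1' + Cl * (m - s)) (z' + Cl * (m - s)) 0 (m - s) (m - s) 0 0 0).
  (* Shut-down limits period 2 of 110 to [a] per unit of weight, so the ramp limits period 1 to
     [a + V], which is within the capacity [b]. *)
  have [Cc abc] : 0 <= Cl * (m - s) /\ (a + V) * (m - s) <= b * (m - s).
    by split; [apply: mulr_ge0|apply: ler_wpM2r].
  apply: (scaledS PB).
  by apply: (@scaled_pattern _ _ _ _ _ _ _ _ _ true true false) => //;
    clear -zb z1b z1z Cc abc Vc;
    rewrite /= ?(subrr, subr0, mulr0, addr0, add0r); splits; lra.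
have P011 : scaled B (n - s)
    (sched3 0 (w + Cl * (n - s)) (w3' + Cl * (n - s)) 0 (n - s) (n - s) (n - s) 0).
  have [Cd abd] : 0 <= Cl * (n - s) /\ (a + V) * (n - s) <= b * (n - s).
    by split; [apply: mulr_ge0|apply: ler_wpM2r].
  apply: (scaledS PB).
  by apply: (@scaled_pattern _ _ _ _ _ _ _ _ _ false true true) => //;
    clear -wb w3b w3w Cd abd Vd;
    rewrite /= ?(subrr, subr0, mulr0, addr0, add0r); splits; lra.
have a_le_b : a <= b by clear -V_ge0 ab; lra.
have single k x : 0 <= k -> 0 <= x <= a * k ->
    [/\ 0 <= Cl * k, 0 <= V * k, Cl * k <= x + Cl * k <= (Cl + b) * k
      & x + Cl * k <= (Cl + a) * k].
  move=> k0 xb; have [Ck Vk abk] : [/\ 0 <= Cl * k, 0 <= V * k & a * k <= b * k].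
    by split; [apply: mulr_ge0|apply: mulr_ge0|apply: ler_wpM2r].
  by clear -Ck Vk abk xb; splits; lra.
have [q qE] : exists q, q = u2 - n + s by eexists.
rewrite -qE in q0 wzt.
have P010 : scaled B q (sched3 0 (X2 - z' - w - t + Cl * q) 0 0 q 0 q 0).
  have x2b : 0 <= X2 - z' - w - t <= a * q by clear -wzt; splits; lra.
  have [Ck Vk x2k x2k'] := single _ _ q0 x2b.
  apply: (scaledS PB).
  by apply: (@scaled_pattern _ _ _ _ _ _ _ _ _ false true false) => //;
    clear -Ck Vk x2k x2k';
    rewrite /= ?(subrr, subr0, mulr0, addr0, add0r, lexx); splits; first [done | lra].
have P100 : scaled B (p - r) (sched3 (h1' + Cl * (p - r)) 0 0 (p - r) 0 0 0 0).
  have [Ck Vk x1k x1k'] := single _ _ pr0 h1p.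
  apply: (scaledS PB).
  by apply: (@scaled_pattern _ _ _ _ _ _ _ _ _ true false false) => //;
    clear -Ck Vk x1k x1k' Vbar0 pr0;
    rewrite /= ?(subrr, subr0, mulr0, addr0, add0r, lexx); splits; first [done | lra].
have P001 : scaled B (u3 - r) (sched3 0 0 (h3' + Cl * (u3 - r)) 0 0 (u3 - r) 0 (u3 - r)).
  have [Ck Vk x3k x3k'] := single _ _ er0 h3p.
  apply: (scaledS PB).
  by apply: (@scaled_pattern _ _ _ _ _ _ _ _ _ false false true) => //;
    clear -Ck Vk x3k x3k' Vbar0 er0;
    rewrite /= ?(subrr, subr0, mulr0, addr0, add0r, lexx); splits; first [done | lra].
have P101 : scaled B r
    (sched3 (h1 - h1' + Cl * r) 0 (h3 - h3' + Cl * r) r 0 r 0 r).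
  have [Ck Vk x1k x1k'] := single _ _ r0 h1r; have [_ _ x3k x3k'] := single _ _ r0 h3r.
  apply: (scaledS PB).
  by apply: (@scaled_pattern _ _ _ _ _ _ _ _ _ true false true) => //;
    clear -Ck Vk x1k x1k' x3k x3k' Vbar0 r0;
    rewrite /= ?(subrr, subr0, mulr0, addr0, add0r, lexx); splits; first [done | lra].
have P000 : scaled B (1 - p - m - u2 - u3 + r) (sched3 0 0 0 0 0 0 0 0).
  have l0 : 0 <= 1 - p - m - u2 - u3 + r by clear -r_ge; lra.
  have Vl : 0 <= (Cl + a) * (1 - p - m - u2 - u3 + r) by apply: mulr_ge0.
  apply: (scaledS PB).
  apply: (@scaled_pattern _ _ _ _ _ _ _ _ _ false false false) => //=.
    by rewrite !mulr0 lexx.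
  by rewrite !(subrr, subr0, mulr0, add0r).
(* The eight weights add up to 1, and a point of the dilate of [B] by 1 lies in [B]. *)
have := scaledD cB (scaledD cB (scaledD cB P111 P110) (scaledD cB P011 P010))
  (scaledD cB (scaledD cB P100 P001) (scaledD cB P101 P000)).
rewrite !sched3D [X in scaled B X _](_ : _ = 1); last by rewrite qE; clear; lra.
move=> [_ [v Bv]]; rewrite scale1r => vE; rewrite -vE in Bv.
by move: Bv; rewrite X1E X3E qE; congr (B (sched3 _ _ _ _ _ _ _ _)); clear; lra.
Qed.

Theorem theorem7 (R : realType) (Cl Cu Vbar V : R)
    (hCl : 0 <= Cl) (hClVbar : Cl <= Vbar) (hVbarCu : Vbar <= Cu)
    (hV : 0 < V)
    (hVbar : Cl + V <= Vbar) (hCu : 0 <= Cu - Vbar - V) :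
  convex_hull (commitment_set 3 1 1 Cl Cu Vbar V) =
  [set z : schedule R 3 |
    let x1 := gen z 1 in let x2 := gen z 2 in let x3 := gen z 3 in
    let y1 := online z 1 in let y2 := online z 2 in let y3 := online z 3 in
    let u2 := startup z 2 in let u3 := startup z 3 in
    y2 - y1 <= u2 /\ y3 - y2 <= u3 /\ 0 <= u2 /\ 0 <= u3 /\
    Cl * y1 <= x1 /\ Cl * y2 <= x2 /\ Cl * y3 <= x3 /\
    u2 <= y2 /\ u3 <= y3 /\ y1 + u2 <= 1 /\ y2 + u3 <= 1 /\
    x1 <= Vbar * y1 + (Cu - Vbar) * (y2 - u2) /\
    x1 <= Vbar * y1 + V * (y2 - u2) + (Cu - Vbar - V) * (y3 - u3) /\
    x2 <= Cu * y2 - (Cu - Vbar) * u2 /\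
    x2 <= Vbar * y2 + (Cu - Vbar) * (y3 - u3) /\
    x3 <= Cu * y3 - (Cu - Vbar) * u3 /\
    x3 <= (Vbar + V) * y3 - V * u3 + (Cu - Vbar - V) * (y2 - u2) /\
    x2 - x1 <= (Cl + V) * y2 - Cl * y1 - (Cl + V - Vbar) * u2 /\
    x3 - x2 <= (Cl + V) * y3 - Cl * y2 - (Cl + V - Vbar) * u3 /\
    x1 - x2 <= Vbar * y1 - (Vbar - V) * y2 - (Cl + V - Vbar) * u2 /\
    x2 - x3 <= Vbar * y2 - (Vbar - V) * y3 - (Cl + V - Vbar) * u3 /\
    x1 - x3 <= Vbar * y1 - Cl * y3 + V * (y2 - u2)
               + (Cl + V - Vbar) * (y3 - u3 - u2) /\
    x3 - x1 <= (Cl + 2 * V) * y3 - Cl * y1 - (Cl + 2 * V - Vbar) * u3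
               - (Cl + V - Vbar) * u2 /\
    (Cu - Cl - 2 * V) * (x1 - Vbar * y1 - V * (y2 - u2))
      <= (Cu - Vbar - V) * (x3 - Cl * y3) /\
    (Cu - Cl - 2 * V) * (x3 - (Vbar + V) * y3 + V * u3)
      <= (Cu - Vbar - V) * (x1 - Cl * y1)].
Proof.
rewrite -/(hull3 Cl Cu Vbar V); apply/seteqP; split.
  apply: smallest_sub; first exact: convex_hull3.
  exact: commitment_set_hull3.
by move=> z hz B [cB PB]; apply: (hull3_sub hCl hV hVbar hCu cB PB).
Qed.
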